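(* Let $b_1,b_2:\mathbb{R}\to\mathbb{R}$ be smooth functions for which there are constants $\underline\beta,\overline\beta$ such that, for $i=1,2$ and all $s\in\mathbb{R}$, $0<\underline\beta\le b_i'(s)\le\overline\beta<\infty$ and $b_i(-s)=-b_i(s)$. For $i=1,2$ let $\hat h_i:[0,\infty)\to[0,\infty)$ be the inverse of the strictly increasing function $[0,\infty)\to[0,\infty)$, $t\mapsto w_{*,i}(t)=\int_0^t b_i(s)\,ds$. Let $n\ge 1$ be a constant real exponent, and assume that there is $\lambda>0$ such that $\hat h_1(w)=\lambda\,\hat h_2(w)$ for all $w\ge 0$. Let $w_*:\mathbb{R}^2\to[0,\infty)$ be the function defined by $w_*(0,0)=0$ and, for $(h_1,h_2)\neq(0,0)$, by letting $w_*=w_*(h_1,h_2)>0$ be the unique positive solution of $$\left|\frac{h_1}{\hat h_1(w_* )}\right|^{n}+\left|\frac{h_2}{\hat h_2(w_* )}\right|^{n}=1.$$ Then $w_*$ is convex on $\mathbb{R}^2$.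
   Context: The functions $b_i$ represent scalar B--H curves (magnetic flux as a function of magnetic field) along the two principal axes, and $w_{*,i}$ are the corresponding coenergies along these axes. ''Smooth'' means infinitely differentiable. Under these hypotheses the displayed equation has exactly one solution $w_*>0$ for every $(h_1,h_2)\neq(0,0)$, so $w_*$ is well defined. *)

(* Defs.v *)
From HB Require Import structures.
From mathcomp Require Import all_boot all_order all_algebra.
From mathcomp Require Import all_classical all_reals all_analysis.

Set Implicit Arguments.
Unset Strict Implicit.
Unset Printing Implicit Defensive.

Import Order.TTheory GRing.Theory Num.Theory.
Import numFieldNormedType.Exports.

Local Open Scope classical_set_scope.
Local Open Scope ring_scope.

Definition smooth (R : realType) (f : R -> R) : Prop :=
  forall (k : nat) (x : R), derivable (f^`(k))%classic x 1.

(* The integral of b from 0 to t, for t >= 0; only these t are used. *)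
Definition coenergy (R : realType) (b : R -> R) (t : R) : R :=
  \int[@lebesgue_measure R]_(s in `[0, t]) b s.

(* Inverse of the coenergy restricted to [0, +oo[. When b is odd with
   0 < beta_lo <= b' <= beta_hi, the coenergy maps [0, +oo[ bijectively onto
   itself, so this is its inverse at every w >= 0; the values at w < 0 are
   irrelevant. *)
Definition hhat (R : realType) (b : R -> R) : R -> R :=
  'pinv_(fun=> 0) (`[0, +oo[ : set R) (coenergy b).

(* [powR] satisfies 0 `^ n = 0 for n != 0, so a vanishing component of h
   contributes nothing. *)
Definition wstar_eq (R : realType) (b1 b2 : R -> R) (n h1 h2 w : R) : Prop :=
  `|h1 / hhat b1 w| `^ n + `|h2 / hhat b2 w| `^ n = 1.

(* [xget 0 P] is an element of P when there is one. When b1, b2 are as above and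
   1 <= n, the set below is a singleton for every h != (0, 0), so the default 0
   is never used and the choice is forced. *)
Definition wstar (R : realType) (b1 b2 : R -> R) (n : R) (h : R^o * R^o) : R :=
  if h == (0, 0) then 0
  else xget 0 [set w : R | 0 < w /\ wstar_eq b1 b2 n h.1 h.2 w].

(* Main.v *)
Require Import Defs.
From HB Require Import structures.
From mathcomp Require Import all_boot all_order all_algebra.
From mathcomp Require Import all_classical all_reals all_analysis.
From mathcomp Require Import ring lra.

Set Implicit Arguments.
Unset Strict Implicit.
Unset Printing Implicit Defensive.

Import Order.TTheory GRing.Theory Num.Theory.
Import numFieldNormedType.Exports.

Local Open Scope classical_set_scope.
Local Open Scope ring_scope.

(** The proportionality of the two inverse coenergies turns the implicit
    equation into an explicit formula.  Write F for the coenergy of b2, g for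
    its inverse on the half-line, and N for the weighted norm
    N(h) = (|h1 / lambda|^n + |h2|^n)^(1/n).  Since the inverse coenergy of b1
    is lambda g, both denominators are multiples of g(w), and the equation reads
    N(h)^n / g(w)^n = 1, that is g(w) = N(h).  Hence w_*(h) = F(N(h))
    ([wstarE]).

    The right-hand side is convex, being the composite of a convex function
    with a convex nondecreasing one.  N is convex by homogeneity ([pnorm2Z]) and
    the triangle inequality ([pnorm2_triangle]), which is where n >= 1 enters,
    through the convexity of s |-> s^n.  F is nondecreasing and convex on the
    half-line ([coenergy_ndecr], [coenergy_convex]) because its derivative b2 is
    nonnegative and nondecreasing there: oddness gives b2(0) = 0, and the lower
    bound on b2' makes b2 strictly increasing.

    Every solution w of the equation lies in the range of F: the pseudo-inverse
    sends a w outside it to 0, and then, since x / 0 = 0, the left-hand side of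
    the equation vanishes ([hhat_neq0K]).  So F(g(w)) = w for each of them. *)

(** * The l^p norm on the plane *)

Section PlanarNorm.
Variable R : realType.
Implicit Types p x y a b c d t u v : R.

Definition pnorm2 p x y : R := (`|x| `^ p + `|y| `^ p) `^ p^-1.

Lemma powRK p x : p != 0 -> 0 <= x -> (x `^ p) `^ p^-1 = x.
Proof. by move=> p0 x0; rewrite -powRrM divff// powRr1. Qed.

Lemma powRVK p x : p != 0 -> 0 <= x -> (x `^ p^-1) `^ p = x.
Proof. by move=> p0 x0; rewrite -powRrM mulVf// powRr1. Qed.

Lemma pnorm2_ge0 p x y : 0 <= pnorm2 p x y.
Proof. exact: powR_ge0. Qed.

Lemma pnorm2_powR p x y : p != 0 -> pnorm2 p x y `^ p = `|x| `^ p + `|y| `^ p.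
Proof. by move=> p0; rewrite powRVK// addr_ge0// powR_ge0. Qed.

Lemma pnorm2_eq0 p x y : p != 0 ->
  (pnorm2 p x y == 0) = (x == 0) && (y == 0).
Proof.
move=> p0; rewrite powR_eq0 invr_eq0 p0 andbT paddr_eq0 ?powR_ge0//.
by rewrite !powR_eq0 p0 !andbT !normr_eq0.
Qed.

Lemma pnorm2Z p t x y : p != 0 -> 0 <= t ->
  pnorm2 p (t * x) (t * y) = t * pnorm2 p x y.
Proof.
move=> p0 t0; rewrite /pnorm2 !normrM (ger0_norm t0) !powRM// -mulrDr.
by rewrite powRM ?powR_ge0 ?addr_ge0 ?powR_ge0// powRK.
Qed.

(** The point (u + v) / (a + c) is the average of u / a and v / c with weights
    a / (a + c) and c / (a + c), so this is Jensen's inequality for the convex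
    function s |-> s^p.  In Minkowski's inequality a and c are the norms of the
    two summands, which makes the weights the same for both coordinates. *)
Lemma powR_mediant p u v a c : 1 <= p -> 0 <= u -> 0 <= v -> 0 < a -> 0 < c ->
  ((u + v) / (a + c)) `^ p <=
  a / (a + c) * (u / a) `^ p + c / (a + c) * (v / c) `^ p.
Proof.
move=> p1 u0 v0 a0 c0; have ac0 : 0 < a + c by exact: addr_gt0.
have t0 : 0 <= a / (a + c) by rewrite divr_ge0// ltW.
have t1 : a / (a + c) <= 1 by rewrite ler_pdivrMr// mul1r lerDl ltW.
have uP : u / a \in `[0, +oo[%classic.
  by rewrite inE/= in_itv/= andbT divr_ge0// ltW.
have vP : v / c \in `[0, +oo[%classic.
  by rewrite inE/= in_itv/= andbT divr_ge0// ltW.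
have H := convex_powR p1 (Itv01 t0 t1) uP vP.
rewrite convRE [X in X `^ _ <= _]convRE/= /unstable.onem in H; move: H.
have -> : 1 - a / (a + c) = c / (a + c) by field; rewrite gt_eqF.
suff -> : a / (a + c) * (u / a) + c / (a + c) * (v / c) = (u + v) / (a + c) by [].
by field; rewrite !gt_eqF.
Qed.

(** Minkowski's inequality in the plane, through the convexity of the unit ball
    rather than through a conjugate exponent: the normalized sum is an average
    of two unit vectors, by [powR_mediant] in each coordinate. *)
Lemma pnorm2_triangle p a b c d : 1 <= p ->
  pnorm2 p (a + c) (b + d) <= pnorm2 p a b + pnorm2 p c d.
Proof.
move=> p1; have p_gt0 : 0 < p by exact: lt_le_trans p1.
have p0 : p != 0 by rewrite gt_eqF.
have [N0|A0] := eqVneq (pnorm2 p a b) 0.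
  move/eqP: (N0); rewrite pnorm2_eq0// => /andP[/eqP-> /eqP->].
  by rewrite !add0r lerDr pnorm2_ge0.
have [N0|C0] := eqVneq (pnorm2 p c d) 0.
  move/eqP: (N0); rewrite pnorm2_eq0// => /andP[/eqP-> /eqP->].
  by rewrite !addr0 lerDl pnorm2_ge0.
have EA := pnorm2_powR a b p0; have EC := pnorm2_powR c d p0.
have {A0} A_gt0 : 0 < pnorm2 p a b by rewrite lt0r A0 pnorm2_ge0.
have {C0} C_gt0 : 0 < pnorm2 p c d by rewrite lt0r C0 pnorm2_ge0.
move: (pnorm2 p a b) (pnorm2 p c d) EA EC A_gt0 C_gt0 => A C EA EC A_gt0 C_gt0.
have A0 : 0 <= A := ltW A_gt0.
have C0 : 0 <= C := ltW C_gt0.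
have S_gt0 : 0 < A + C by exact: addr_gt0.
rewrite -[leRHS](powRK p0) ?(ltW S_gt0)//.
apply: ge0_ler_powR; rewrite ?nnegrE ?invr_ge0 ?(ltW p_gt0) ?addr_ge0 ?powR_ge0//.
have part (x y : R) : `|x + y| `^ p <= (A + C) `^ p *
    (A / (A + C) * (`|x| / A) `^ p + C / (A + C) * (`|y| / C) `^ p).
  apply: (@le_trans _ _ ((`|x| + `|y|) `^ p)).
    by apply: ge0_ler_powR; rewrite ?nnegrE ?addr_ge0 ?ler_normD// ltW.
  rewrite -{1}(divfK (lt0r_neq0 S_gt0) (`|x| + `|y|)) mulrC.
  rewrite powRM ?(ltW S_gt0) ?divr_ge0 ?addr_ge0 ?(ltW S_gt0)//.
  by rewrite ler_wpM2l ?powR_ge0// powR_mediant.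
apply: (le_trans (lerD (part a c) (part b d))).
have cancelp r x y : 0 < r -> r `^ p = `|x| `^ p + `|y| `^ p ->
    (`|x| / r) `^ p + (`|y| / r) `^ p = 1.
  move=> r0 Er; have r1 : 0 <= r^-1 by rewrite invr_ge0 ltW.
  by rewrite !powRM// -mulrDl -Er -powRM ?(ltW r0)// divff ?gt_eqF// powR1.
rewrite -mulrDr addrACA -!mulrDr !cancelp// !mulr1 -mulrDl divff ?gt_eqF//.
by rewrite mulr1.
Qed.

End PlanarNorm.

(** * The coenergy on the half-line *)

Section Coenergy.
Variable R : realType.
Implicit Types (b : R -> R) (x y t : R).

(** The fundamental theorem of calculus only gives the derivative at positive
    points, since the coenergy is constant to the left of 0; the endpoint x = 0
    is covered by continuity. *)
Lemma coenergy_MVT b x y : continuous b -> 0 <= x -> x < y ->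
  exists2 c, x < c < y & coenergy b y - coenergy b x = b c * (y - x).
Proof.
move=> cb x0 xy.
have intb u : lebesgue_measure.-integrable `[0, u] (EFin \o b).
  apply: continuous_compact_integrable; first exact: segment_compact.
  exact: continuous_subspaceT.
have dF c : c \in `]x, y[ -> is_derive c 1 (coenergy b) (b c).
  rewrite in_itv/= => /andP[xc cy].
  have c0 : 0 < c by exact: le_lt_trans xc.
  have [dc <-] := continuous_FTC1_closed cy (intb y) c0 (cb c).
  by rewrite derive1E; exact: derivableP.
have cF : {within `[x, y], continuous (coenergy b)}.
  have := parameterized_integral_continuous (le_trans x0 (ltW xy)) (intb y).
  apply: continuous_subspaceW => z/=; rewrite !in_itv/= => /andP[xz ->].
  by rewrite andbT (le_trans x0).
have [c] := MVT xy dF cF.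
by rewrite in_itv/=; exists c.
Qed.

Lemma coenergy0 b : coenergy b 0 = 0.
Proof. by rewrite /coenergy set_itv1 Rintegral_set1. Qed.

Lemma coenergy_incr b x y : continuous b -> (forall t, 0 < t -> 0 < b t) ->
  0 <= x -> x < y -> coenergy b x < coenergy b y.
Proof.
move=> cb b_gt0 x0 xy; have [c /andP[xc cy] E] := coenergy_MVT cb x0 xy.
rewrite -subr_gt0 E mulr_gt0 ?subr_gt0//.
by apply: b_gt0; exact: le_lt_trans xc.
Qed.

Lemma coenergy_ndecr b x y : continuous b -> (forall t, 0 < t -> 0 < b t) ->
  0 <= x -> x <= y -> coenergy b x <= coenergy b y.
Proof.
move=> cb b_gt0 x0; rewrite le_eqVlt => /predU1P[->//|xy].
exact/ltW/coenergy_incr.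
Qed.

(** The graph of the coenergy lies above its tangents: in the mean value
    formula b is evaluated between x and y, so at a value at least b x when x < y
    and at most b x when y < x. *)
Lemma coenergy_tangent b x y : continuous b -> {homo b : s t / s <= t} ->
  0 <= x -> 0 <= y -> b x * (y - x) <= coenergy b y - coenergy b x.
Proof.
move=> cb ndb x0 y0; case: (ltgtP x y) => [xy|yx|->]; last by rewrite !subrr mulr0.
- have [c /andP[xc cy] ->] := coenergy_MVT cb x0 xy.
  by rewrite ler_wpM2r ?subr_ge0 ?(ltW xy)// ndb ?(ltW xc).
- have [c /andP[xc cy] E] := coenergy_MVT cb y0 yx.
  rewrite -lerN2 opprB E -mulrN opprB.
  by rewrite ler_wpM2r ?subr_ge0 ?(ltW yx)// ndb ?(ltW cy).
Qed.

(** Average the two tangent inequalities at the intermediate point z: their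
    linear terms cancel. *)
Lemma coenergy_convex b x y t : continuous b -> {homo b : s t / s <= t} ->
  0 <= x -> 0 <= y -> 0 <= t <= 1 ->
  coenergy b (t * x + (1 - t) * y) <= t * coenergy b x + (1 - t) * coenergy b y.
Proof.
move=> cb ndb x0 y0 /andP[t0 t1].
have t'0 : 0 <= 1 - t by rewrite subr_ge0.
set z := t * x + _.
have z0 : 0 <= z by rewrite addr_ge0 ?mulr_ge0.
have Hx := ler_wpM2l t0 (coenergy_tangent cb ndb z0 x0).
have Hy := ler_wpM2l t'0 (coenergy_tangent cb ndb z0 y0).
have := lerD Hx Hy.
have -> : t * (b z * (x - z)) + (1 - t) * (b z * (y - z)) = 0 by rewrite /z; ring.
lra.
Qed.

End Coenergy.

(** * Functions with a positive derivative *)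

Section PositiveDerivative.
Variables (R : realType) (b : R -> R).
Hypothesis db : forall x, derivable b x 1.

Lemma derivable1_continuous : continuous b.
Proof. by move=> x; apply: differentiable_continuous; exact/derivable1_diffP. Qed.

Lemma derive1_gt0_incr :
  (forall s, 0 < b^`()%classic s) -> {homo b : s t / s < t}.
Proof.
move=> b'_gt0 s t st.
apply: (@gtr0_derive1_lt_cc R b s t) => //; last 2 first.
- by rewrite in_itv/= lexx ltW.
- by rewrite in_itv/= lexx ltW.
by apply: continuous_subspaceT; exact: derivable1_continuous.
Qed.

End PositiveDerivative.

(** * The inverse coenergy and the explicit form of w_* *)

Lemma pinv_dfltE (T U : Type) (dflt : U -> T) (A : set T) (f : T -> U) (y : U) :
  ~ (f @` A) y -> 'pinv_dflt A f y = dflt y.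
Proof.
move=> nfAy; rewrite /pinv_ splitV.
have -> : 'oinv_[fun f in A] y = None by rewrite oinv_surj; case: pselect.
by [].
Qed.

Section Hhat.
Variables (R : realType) (b : R -> R).
Hypotheses (cb : continuous b) (b_gt0 : forall t, 0 < t -> 0 < b t).

Lemma coenergy_inj : {in `[0, +oo[%classic &, injective (coenergy b)}.
Proof.
move=> x y; rewrite !inE/= !in_itv/= !andbT => x0 y0 E.
case: (ltgtP x y) => // [xy|yx].
- by have := coenergy_incr cb b_gt0 x0 xy; rewrite E ltxx.
- by have := coenergy_incr cb b_gt0 y0 yx; rewrite E ltxx.
Qed.

Lemma coenergyK x : 0 <= x -> hhat b (coenergy b x) = x.
Proof.
by move=> x0; apply: (pinvKV (fun=> 0) coenergy_inj); rewrite inE/= in_itv/= andbT.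
Qed.

(** A nonzero value of the pseudo-inverse cannot be the default one, so it
    certifies that w is in the range of the coenergy. *)
Lemma hhat_neq0K w : hhat b w != 0 -> 0 <= hhat b w /\ coenergy b (hhat b w) = w.
Proof.
have [[x /=]|nw] := pselect ((coenergy b @` `[0, +oo[) w).
  by rewrite in_itv/= andbT => x0 <- _; rewrite coenergyK.
by rewrite /hhat pinv_dfltE// eqxx.
Qed.

End Hhat.

(** At positive values of the inverse coenergy g, the equation says that
    N^n g^-n = 1, that is g w = N; so w = F(N) solves it, F being the coenergy
    of b2.  Any solution w has g w != 0, since otherwise the left-hand side is
    0, and then w = F(g w) = F(N). *)
Lemma wstarE (R : realType) (b1 b2 : R -> R) (n lambda : R) (h : R^o * R^o) :
  continuous b2 -> (forall t, 0 < t -> 0 < b2 t) -> 1 <= n -> 0 < lambda ->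
  (forall w : R, 0 <= w -> hhat b1 w = lambda * hhat b2 w) ->
  wstar b1 b2 n h = coenergy b2 (pnorm2 n (h.1 / lambda) h.2).
Proof.
move=> cb b_gt0 n1 l0 hh; have n_gt0 : 0 < n by exact: lt_le_trans n1.
have n0 : n != 0 by rewrite gt_eqF.
have ln0 : lambda != 0 by rewrite gt_eqF.
case: h => h1 h2; rewrite /wstar/=; set N := pnorm2 _ _ _.
have N_ge0 : 0 <= N := pnorm2_ge0 _ _ _.
have N0 : (N == 0) = ((h1, h2) == (0, 0)).
  by rewrite /N pnorm2_eq0// mulf_eq0 invr_eq0 (negbTE ln0) orbF.
have [E|hN0] := eqVneq (h1, h2) (0, 0).
  by move: N0; rewrite E eqxx => /eqP ->; rewrite coenergy0.
have N_gt0 : 0 < N by rewrite lt0r N0 hN0.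
have eqN (w : R) : 0 <= w -> 0 <= hhat b2 w -> hhat b2 w != 0 ->
    wstar_eq b1 b2 n h1 h2 w <-> hhat b2 w = N.
  move=> w0 g_ge0 g0; rewrite /wstar_eq hh// invfM mulrA !normrM.
  have g_gt0 : 0 < hhat b2 w by rewrite lt0r g0.
  have g1 : 0 <= (hhat b2 w)^-1 by rewrite invr_ge0.
  rewrite -normrM (ger0_norm g1) !powRM// -mulrDl -(pnorm2_powR _ _ n0) -/N.
  rewrite -powRM//; split=> [/eqP|->]; last by rewrite divff ?powR1 ?gt_eqF.
  rewrite powR_eq1 (negbTE n0) orbF => /orP[/eqP E|]; last first.
    by rewrite ltNge mulr_ge0.
  by rewrite -[RHS](divfK g0) E mul1r.
apply: xget_unique => /=.
  have FN_gt0 : 0 < coenergy b2 N by rewrite -(coenergy0 b2) coenergy_incr.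
  by split=> //; apply/eqN; rewrite ?coenergyK// ?(ltW FN_gt0)// gt_eqF.
move=> w [w0 Ew]; have g0 : hhat b2 w != 0.
  apply/eqP => g0; move: Ew; rewrite /wstar_eq hh ?(ltW w0)// g0 mulr0 invr0.
  by rewrite !mulr0 normr0 powR0// addr0 => /esym/eqP; rewrite oner_eq0.
have [g_ge0 Fg] := hhat_neq0K cb b_gt0 g0.
by rewrite -Fg (iffLR (eqN _ (ltW w0) g_ge0 g0) Ew).
Qed.

Theorem lemma4 (R : realType) (b1 b2 : R -> R) (beta_lo beta_hi n lambda : R)
  (b1_smooth : smooth b1) (b2_smooth : smooth b2)
  (beta_lo_gt0 : 0 < beta_lo)
  (b1_bounds : forall s : R, beta_lo <= b1^`()%classic s <= beta_hi)
  (b2_bounds : forall s : R, beta_lo <= b2^`()%classic s <= beta_hi)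
  (b1_odd : forall s : R, b1 (- s) = - b1 s)
  (b2_odd : forall s : R, b2 (- s) = - b2 s)
  (n_ge1 : 1 <= n)
  (lambda_gt0 : 0 < lambda)
  (hhat_prop : forall w : R, 0 <= w -> hhat b1 w = lambda * hhat b2 w) :
  @convex_function R (R^o * R^o)%type setT (wstar b1 b2 n).
Proof.
have db x : derivable b2 x 1 := b2_smooth 0%N x.
have cb : continuous b2 := derivable1_continuous db.
have incb : {homo b2 : s t / s < t}.
  apply: (derive1_gt0_incr db) => s; have /andP[+ _] := b2_bounds s.
  exact: lt_le_trans.
have ndb : {homo b2 : s t / s <= t} by exact: ltW_homo.
have b0 : b2 0 = 0 by have := b2_odd 0; rewrite oppr0; lra.
have b_gt0 t : 0 < t -> 0 < b2 t by rewrite -{2}b0 => /incb.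
have n0 : n != 0 by rewrite gt_eqF// (lt_le_trans ltr01).
have wE h := wstarE h cb b_gt0 n_ge1 lambda_gt0 hhat_prop.
move=> t [x1 x2] [y1 y2] _ _; rewrite convRE !wE /unstable.onem.
have t0 : 0 <= t%:num by [].
have t1 : t%:num <= 1 by [].
rewrite [X in X.1](_ : _ = (t%:num * x1 + (1 - t%:num) * y1,
                             t%:num * x2 + (1 - t%:num) * y2))//=.
move: (t%:num) t0 t1 => s s0 s1; have s'0 : 0 <= 1 - s by rewrite subr_ge0.
set N := pnorm2 n; set F := coenergy b2.
apply: (@le_trans _ _ (F (s * N (x1 / lambda) x2 + (1 - s) * N (y1 / lambda) y2))).
  apply: (coenergy_ndecr cb b_gt0); first exact: pnorm2_ge0.
  by rewrite /N -!pnorm2Z// mulrDl !mulrA pnorm2_triangle.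
by apply: coenergy_convex => //; rewrite ?pnorm2_ge0// s0 s1.
Qed.
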